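(* Let $(U,\varphi)$ be a finite standard closure space whose lattice of closed sets is geometric. Then the (aggregated) $E$-base of $(U,\varphi)$ is valid if and only if the essential sets of $(U,\varphi)$ are pairwise incomparable under inclusion.
   Context: A closure space $(U,\varphi)$: finite $U$ with closure operator $\varphi$; closed sets form a lattice under inclusion. Standard: $\varphi(\{x\})\setminus\{x\}$ closed for all $x$. Geometric lattice: atomistic (every join-irreducible element covers the bottom) and upper-semimodular. Quasi-closed $Q$: for all $X\subseteq Q$ with $\varphi(X)\subsetneq\varphi(Q)$, $\varphi(X)\subseteq Q$. Pseudo-closed $P$: not closed and inclusion-minimal among quasi-closed $Q$ with $\varphi(Q)=\varphi(P)$. Essential set: $\varphi(P)$ for $P$ pseudo-closed. $\varphi^b(X)=\bigcup_{x\in X}\varphi(\{x\})$. $D$-generator of $x$: $A$ with $x\in\varphi(A)$, $x\notin\varphi^b(A)$, and $x\notin\varphi(B)$ whenever $\varphi^b(B)\subsetneq\varphi^b(A)$. $E$-generator of $x$: $D$-generator $A$ with $\varphi(A)$ inclusion-minimal among closures of $D$-generators of $x$. The $E$-base is $\Sigma_E=\{a\to x: x\neq a,x\in\varphi(\{a\})\}\cup\{A\to x: A \text{ an } E\text{-generator of } x\}$ (aggregated: implications with equal premises merged). A set $\Sigma$ of implications induces the closure operator whose closed sets $C$ satisfy $A\subseteq C\Rightarrow X\subseteq C$ for all $A\to X\in\Sigma$; $\Sigma_E$ is valid if this operator equals $\varphi$. *)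

(* Defs.v *)
From HB Require Import structures.
From mathcomp Require Import all_boot all_order.

Set Implicit Arguments.
Unset Strict Implicit.
Unset Printing Implicit Defensive.

Import Order.TTheory.
Local Open Scope order_scope.

Section GeometricLattices.
Variables (d : Order.disp_t) (L : finTBLatticeType d).
Implicit Types a b c j : L.

Definition lcovers a b : bool := (a < b) && [forall c, ~~ (a < c < b)].

Definition join_irreducible j : bool :=
  (j != \bot) && [forall a, forall b, (j == a `|` b) ==> (j == a) || (j == b)].

Definition atomistic : bool :=
  [forall j, join_irreducible j ==> lcovers \bot j].

Definition upper_semimodular : bool :=
  [forall a, forall b, lcovers (a `&` b) a ==> lcovers b (a `|` b)].

Definition geometric : bool := atomistic && upper_semimodular.

End GeometricLattices.

Arguments geometric {d} L.

(* The ground set of a closure space is the whole finite type U. *)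
Record closure_op (U : finType) := ClosureOp {
  clop :> {set U} -> {set U};
  clop_ext : forall X : {set U}, X \subset clop X;
  clop_mono : forall X Y : {set U}, X \subset Y -> clop X \subset clop Y;
  clop_idem : forall X : {set U}, clop (clop X) = clop X
}.

Section ClosedSetLattice.
Variables (U : finType) (phi : closure_op U).

Definition closed (C : {set U}) : bool := phi C == C.

Record closed_set := ClosedSet { cset :> {set U}; csetP : closed cset }.

HB.instance Definition _ := [isSub for cset].
HB.instance Definition _ := [Finite of closed_set by <:].

Implicit Types A B C : closed_set.

Lemma closed_clop (X : {set U}) : closed (phi X).
Proof. by rewrite /closed clop_idem. Qed.

Lemma clop_subset (X : {set U}) C : (phi X \subset C) = (X \subset C).
Proof.
apply/idP/idP => [|XC]; first exact: subset_trans (clop_ext phi X).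
by rewrite -(eqP (csetP C)); apply: clop_mono.
Qed.

Lemma closed_setI A B : closed (A :&: B).
Proof.
rewrite /closed eqEsubset clop_ext andbT subsetI !clop_subset.
by rewrite subsetIl subsetIr.
Qed.

Definition cset_meet A B : closed_set := ClosedSet (closed_setI A B).
Definition cset_join A B : closed_set := ClosedSet (closed_clop (A :|: B)).
Definition cset_bot : closed_set := ClosedSet (closed_clop set0).
Definition cset_top : closed_set := ClosedSet (closed_clop setT).

Definition cset_le : rel closed_set := fun A B => cset A \subset cset B.

Lemma cset_le_refl : reflexive cset_le.
Proof. by move=> A; apply: subxx. Qed.

Lemma cset_le_anti : antisymmetric cset_le.
Proof. by move=> A B AB; apply: val_inj; apply/eqP; rewrite eqEsubset. Qed.

Lemma cset_le_trans : transitive cset_le.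
Proof. by move=> B A C; apply: subset_trans. Qed.

Fact closed_set_display : Order.disp_t. Proof. exact: Order.Disp tt tt. Qed.

HB.instance Definition _ :=
  Order.Le_isPOrder.Build closed_set_display closed_set
    cset_le_refl cset_le_anti cset_le_trans.

Lemma cset_lexI A B C : (A <= cset_meet B C) = (A <= B) && (A <= C).
Proof. exact: subsetI. Qed.

Lemma cset_leUx A B C : (cset_join A B <= C) = (A <= C) && (B <= C).
Proof. by rewrite -subUset -clop_subset. Qed.

Lemma cset_le0x A : cset_bot <= A.
Proof. by rewrite /Order.le /= /cset_le clop_subset sub0set. Qed.

Lemma cset_lex1 A : A <= cset_top.
Proof. exact: subset_trans (subsetT A) (clop_ext phi setT). Qed.

HB.instance Definition _ :=
  Order.POrder_isMeetSemilattice.Build closed_set_display closed_set cset_lexI.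
HB.instance Definition _ :=
  Order.POrder_isJoinSemilattice.Build closed_set_display closed_set cset_leUx.
HB.instance Definition _ :=
  Order.hasBottom.Build closed_set_display closed_set cset_le0x.
HB.instance Definition _ :=
  Order.hasTop.Build closed_set_display closed_set cset_lex1.

End ClosedSetLattice.

Section Implications.
Variable U : finType.
Implicit Types (S : {set {set U} * {set U}}) (X C : {set U}).

(* The pair (A, Y) stands for the implication A -> Y. *)
Definition imp_closed S C : bool :=
  [forall i in S, (i.1 \subset C) ==> (i.2 \subset C)].

Definition imp_closure S X : {set U} :=
  \bigcap_(C : {set U} | imp_closed S C && (X \subset C)) C.

Definition unit_conclusions (T : {set {set U} * U}) (A : {set U}) : {set U} :=
  [set x | (A, x) \in T].

Definition aggregate (T : {set {set U} * U}) : {set {set U} * {set U}} :=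
  [set (i.1, unit_conclusions T i.1) | i in T].

End Implications.

Section EBase.
Variables (U : finType) (phi : closure_op U).
Implicit Types (A B P Q X : {set U}) (x : U).

Definition standard : bool := [forall x, closed phi (phi [set x] :\ x)].

Definition quasi_closed Q : bool :=
  [forall X : {set U},
     (X \subset Q) && (phi X \proper phi Q) ==> (phi X \subset Q)].

Definition pseudo_closed P : bool :=
  [&& ~~ closed phi P, quasi_closed P &
      [forall Q : {set U},
         quasi_closed Q && (phi Q == phi P) ==> ~~ (Q \proper P)]].

Definition essential_sets : {set {set U}} :=
  [set phi P | P : {set U} & pseudo_closed P].

Definition clop_b X : {set U} := \bigcup_(x in X) phi [set x].

Definition D_generator x A : bool :=
  [&& x \in phi A, x \notin clop_b A &
      [forall B : {set U}, (clop_b B \proper clop_b A) ==> (x \notin phi B)]].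

Definition E_generator x A : bool :=
  D_generator x A &&
  [forall B : {set U}, D_generator x B ==> ~~ (phi B \proper phi A)].

Definition unit_E_base : {set {set U} * U} :=
  [set ([set ax.1], ax.2) | ax : U * U
     & (ax.2 != ax.1) && (ax.2 \in phi [set ax.1])]
  :|: [set Ax : {set U} * U | E_generator Ax.2 Ax.1].

Definition E_base : {set {set U} * {set U}} := aggregate unit_E_base.

Definition valid_base (S : {set {set U} * {set U}}) : Prop :=
  imp_closure S =1 phi.

End EBase.

(* Main.v *)
(** A standard closure space with a geometric lattice of closed sets is a simple
    matroid: [phi [set x] = [set x]] and the exchange property holds.  Hence
    [clop_b X = X], and the [D]-generators of [x] are the minimal sets [A]
    avoiding [x] with [x] in [phi A].

    If [C] respects the [E]-base but is not closed, take [F = phi X] minimal with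
    [X] inside [C] and [phi X] not inside [C]: then [F :&: C] is quasi-closed and
    not closed, so [F] is essential.  A minimal generator of some [x] in
    [F :\: C] cannot be an [E]-generator, so [x] has an [E]-generator spanning a
    proper subset [G] of [F]; as [G :\ x] is quasi-closed and not closed, [G] is
    essential too, and the essential sets are not an antichain.

    Conversely, let [F] be essential and call [x] good if it has an [E]-generator
    spanning [F], i.e. if [x] depends on other elements of [F] but every set on
    which it depends nontrivially inside [F] spans [F].  If the [E]-base is valid,
    a quasi-closed set spanning [F] and containing all good elements must be [F].
    If the set of good elements spans [F], it is itself quasi-closed, hence equal
    to [F], which is impossible when [F] properly contains another essential set.
    Otherwise pick a good [x] and a maximal closed subset [H] of [F] containing
    the other good elements but not [x]: exchange shows that [x |: H] is
    quasi-closed and spans [F], but it is not [F]. *)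
From mathcomp Require Import all_boot all_order.
Require Import Defs.

Import Order.Theory.

Set Implicit Arguments.
Unset Strict Implicit.
Unset Printing Implicit Defensive.

(** * Closures and quasi-closed sets *)

Section ClosureSpace.
Variables (U : finType) (phi : closure_op U).
Implicit Types (A B C F H P Q X Y : {set U}) (x y z : U).

Lemma mem_clop X x : x \in X -> x \in phi X.
Proof. by move=> xX; apply: (subsetP (clop_ext phi X)). Qed.

Lemma mem_clopS X Y x : X \subset Y -> x \in phi X -> x \in phi Y.
Proof. by move=> XY; apply: (subsetP (clop_mono phi XY)). Qed.

Lemma clop_sub_closed X F : closed phi F -> X \subset F -> phi X \subset F.
Proof. by move=> /eqP {2}<-; apply: clop_mono. Qed.

Lemma clop_sub X Y : X \subset phi Y -> phi X \subset phi Y.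
Proof. exact/clop_sub_closed/closed_clop. Qed.

Lemma quasi_closedP Q :
  reflect (forall X z, X \subset Q -> phi X \proper phi Q ->
             z \in phi X -> z \in Q)
          (quasi_closed phi Q).
Proof.
apply: (iffP forallP) => [qcQ X z XQ XltQ zX | h X].
  by move: (implyP (qcQ X)); rewrite XQ XltQ => /(_ isT)/subsetP; apply.
by apply/implyP => /andP[XQ XltQ]; apply/subsetP => z; apply: h XQ XltQ.
Qed.

(** A minimal quasi-closed subset of [Q] with the same closure is pseudo-closed: were it closed, it
    would equal [phi Q], hence [Q]. *)
Lemma quasi_closed_essential Q :
  quasi_closed phi Q -> ~~ closed phi Q -> phi Q \in essential_sets phi.
Proof.
move=> qcQ ncQ; pose p X := quasi_closed phi X && (phi X == phi Q).
have [|P minP PQ] := @minset_exists _ p Q; first by rewrite /p qcQ eqxx.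
have /andP[qcP /eqP ePQ] := minsetp minP.
apply/imsetP; exists P => //; rewrite inE /pseudo_closed qcP /=.
apply/andP; split.
  apply: contra ncQ => /eqP cP; rewrite /closed.
  have -> : Q = P by apply/eqP; rewrite eqEsubset PQ -cP ePQ clop_ext.
  by rewrite cP.
apply/forallP => X; apply/implyP => /andP[qcX /eqP eX].
apply/negP => /properP[XP [z zP]]; rewrite (minsetinf minP _ XP) ?zP //.
by rewrite /p qcX eX ePQ eqxx.
Qed.

(** * From a geometric lattice to a simple matroid *)

Lemma standard_clop0 : standard phi -> phi set0 = set0.
Proof.
move/forallP=> st; apply/eqP; rewrite -subset0; apply/subsetP => x x0.
have /eqP cx := st x; have : x \in phi (phi [set x] :\ x).
  exact: mem_clopS (sub0set _) x0.
by rewrite cx !inE eqxx.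
Qed.

(** Two closed subsets of [phi [set x]] that both miss [x] lie in the closed set [phi [set x] :\ x],
    and so does their join. *)
Lemma standard_join_irreducible x :
  standard phi ->
  join_irreducible (ClosedSet (closed_clop phi [set x])).
Proof.
move=> st; have /forallP/(_ x)/eqP cx := st; apply/andP; split.
  apply/eqP => /(congr1 (@cset _ _)) /= e.
  have : x \in phi [set x] by rewrite mem_clop ?set11.
  by rewrite e standard_clop0 ?inE.
apply/forallP => A; apply/forallP => B; apply/implyP => /eqP e.
have eAB : phi [set x] = phi (A :|: B) := congr1 (@cset _ _) e.
have AB : A :|: B \subset phi [set x] by rewrite eAB clop_ext.
have small (D : closed_set phi) :
    D \subset phi [set x] -> x \in D -> ClosedSet (closed_clop phi [set x]) == D.
  move=> Dx xD; apply/eqP/val_inj/eqP => /=.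
  by rewrite eqEsubset Dx andbT clop_sub_closed ?csetP ?sub1set.
move: (AB); rewrite subUset => /andP[Ax Bx].
have [/(small _ Ax) -> // | xA] := boolP (x \in cset A).
have [/(small _ Bx) -> | xB] := boolP (x \in cset B); first by rewrite orbT.
have /(mem_clopS (x := x)) : A :|: B \subset phi [set x] :\ x.
  by rewrite subsetD1 AB inE (negPf xA) (negPf xB).
by rewrite -eAB cx !inE eqxx mem_clop ?set11 //= => /(_ isT).
Qed.

Lemma atomistic_clop1 x :
  standard phi -> atomistic (closed_set phi) -> phi [set x] = [set x].
Proof.
move=> st /forallP/(_ (ClosedSet (closed_clop phi [set x]))).
rewrite standard_join_irreducible //= => /andP[_ /forallP nlt].
have /forallP/(_ x) cx := st.
have xx : x \in phi [set x] by rewrite mem_clop ?set11.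
have := nlt (ClosedSet cx); rewrite !lt_neqAle !negb_and.
rewrite !negbK => /orP[/orP[/eqP|] | /orP[/eqP|]].
- move=> /(congr1 (@cset _ _)) /= e; rewrite -(setD1K xx) -e.
  by rewrite standard_clop0 ?setU0.
- by rewrite le0x.
- by move=> /(congr1 (@cset _ _)) /= e; move: xx; rewrite -e !inE eqxx.
- by rewrite /Order.le /= /cset_le /= subsetDl.
Qed.

(** The atom [phi [set x]] meets [phi X] in the bottom, so by semimodularity their join covers
    [phi X]; [phi (y |: X)] lies strictly above [phi X] and inside the join, so it is the join. *)
Lemma geometric_exchange X x y :
  standard phi -> geometric (closed_set phi) ->
  y \in phi (x |: X) -> y \notin phi X -> x \in phi (y |: X).
Proof.
move=> st /andP[at_ sm] yxX yX.
have xX : x \notin phi X.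
  apply: contra yX => xX; apply: (subsetP _ y yxX).
  by rewrite clop_sub // subUset sub1set xX clop_ext.
pose a := ClosedSet (closed_clop phi [set x]).
pose b := ClosedSet (closed_clop phi X).
pose c := ClosedSet (closed_clop phi (y |: X)).
have ab : Order.meet a b = Order.bottom.
  apply/val_inj => /=; rewrite atomistic_clop1 // standard_clop0 //.
  by apply/setP => z; rewrite !inE; case: eqP => //= ->; apply/negbTE.
have := forallP (forallP sm a) b; rewrite ab.
have -> : lcovers Order.bottom a.
  exact: implyP (forallP at_ a) (standard_join_irreducible x st).
case/andP=> _ /forallP/(_ c); rewrite negb_and !lt_neqAle.
rewrite !negb_and !negbK.
have yy : y \in phi (y |: X) by rewrite mem_clop ?setU11.
case/orP => /orP[/eqP/(congr1 (@cset _ _)) /= e|].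
- by rewrite e yy in yX.
- by rewrite /Order.le /= /cset_le /= clop_mono // subsetUr.
- rewrite e; apply: mem_clop; rewrite inE; apply/orP; left.
  by rewrite mem_clop ?set11.
- rewrite /Order.le /= /cset_le /= => /negP[]; apply: clop_sub.
  rewrite subUset sub1set; apply/andP; split; last first.
    by apply: subset_trans (clop_ext _ _); rewrite subsetU ?clop_ext ?orbT.
  apply: mem_clopS yxX; rewrite subUset sub1set !inE mem_clop ?set11 //=.
  by rewrite subsetU ?clop_ext ?orbT.
Qed.

(** * Generators when singletons are closed *)

Section Atomic.
Hypothesis clop1 : forall x, phi [set x] = [set x].

Lemma clop_b_id X : clop_b phi X = X.
Proof.
apply/setP => x; apply/bigcupP/idP => [[y yX]|xX].
  by rewrite clop1 inE => /eqP->.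
by exists x; rewrite ?clop1 ?set11.
Qed.

Lemma D_generatorP x A :
  reflect [/\ x \in phi A, x \notin A & forall B, B \proper A -> x \notin phi B]
          (D_generator phi x A).
Proof.
rewrite /D_generator clop_b_id.
apply: (iffP and3P) => [[xA xnA /forallP minA]|[xA xnA minA]]; split=> //.
  by move=> B BA; apply: implyP (minA B) _; rewrite clop_b_id.
by apply/forallP => B; apply/implyP; rewrite clop_b_id; apply: minA.
Qed.

Lemma D_generator_exists x X :
  x \in phi X -> x \notin X ->
  exists2 A : {set U}, A \subset X & D_generator phi x A.
Proof.
move=> xX xnX.
have [A minA AX] := @minset_exists _ (fun A => x \in phi A) X xX.
exists A => //; apply/D_generatorP; split; first exact: minsetp minA.
  by apply: contra xnX; apply: (subsetP AX).
move=> B /properP[BA [z zA zB]]; apply: contra zB => xB.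
by rewrite (minsetinf minA xB BA).
Qed.

Lemma E_generator_exists x A :
  D_generator phi x A ->
  exists2 B : {set U}, E_generator phi x B & phi B \subset phi A.
Proof.
move=> genA.
have [B /andP[genB BA] minB] := @arg_minnP _ A
  (fun B => D_generator phi x B && (phi B \subset phi A)) (fun B => #|phi B|)
  (introT andP (conj genA (subxx _))).
exists B => //; rewrite /E_generator genB; apply/forallP => C.
apply/implyP => genC; apply/negP => CB; have := proper_card CB.
by rewrite ltnNge minB // genC (subset_trans (proper_sub CB)).
Qed.

(** [X] contains a [D]-generator of [x], whose closure cannot be strictly smaller than [phi A]. *)
Lemma E_generator_span x A X :
  E_generator phi x A -> X \subset phi A -> x \in phi X -> x \notin X ->
  phi X = phi A.
Proof.
move=> /andP[_ /forallP minA] XA xX xnX.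
have [B BX genB] := D_generator_exists xX xnX.
have BA : phi B \subset phi A by rewrite clop_sub // (subset_trans BX).
have := implyP (minA B) genB; rewrite properE BA negbK => AB.
by apply/eqP; rewrite eqEsubset clop_sub // (subset_trans AB) // clop_mono.
Qed.

Lemma E_generator_essential x A :
  E_generator phi x A -> phi A \in essential_sets phi.
Proof.
move=> genA; have /andP[/D_generatorP[xA xnA _] _] := genA.
have e : phi (phi A :\ x) = phi A.
  apply/eqP; rewrite eqEsubset clop_sub ?subsetDl // clop_mono //.
  by rewrite subsetD1 clop_ext.
rewrite -e; apply: quasi_closed_essential.
  apply/quasi_closedP => X z; rewrite e subsetD1 => /andP[XA xnX].
  move=> XltA zX; rewrite !inE (subsetP (proper_sub XltA)) // andbT.
  apply/eqP => zx; rewrite zx in zX; move: XltA.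
  by rewrite (E_generator_span genA XA zX xnX) properxx.
by apply/eqP => cA; move: xA; rewrite -e cA !inE eqxx.
Qed.

(** * Validity of the [E]-base, and its proof from the antichain condition *)

Lemma imp_closed_E_baseP C :
  reflect (forall A x, E_generator phi x A -> A \subset C -> x \in C)
          (imp_closed (E_base phi) C).
Proof.
have mem_base A x : ((A, x) \in unit_E_base phi) = E_generator phi x A.
  rewrite !inE /=; case: imsetP => // -[[a y] /=].
  by rewrite !inE clop1 inE /= => /andP[/negP].
apply: (iffP forall_inP) => [clC A x genA AC | h i /imsetP[[A x] Ax ->]] /=.
  have : (A, unit_conclusions (unit_E_base phi) A) \in E_base phi.
    by apply/imsetP; exists (A, x); rewrite ?mem_base.
  move=> /clC /implyP/(_ AC)/subsetP; apply.
  by rewrite inE mem_base.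
apply/implyP => AC; apply/subsetP => y; rewrite inE mem_base => genA.
exact: h genA AC.
Qed.

Lemma E_base_validP :
  valid_base phi (E_base phi) <->
  (forall C, (forall A x, E_generator phi x A -> A \subset C -> x \in C) ->
     closed phi C).
Proof.
split=> [valid C /imp_closed_E_baseP clC | complete X].
  rewrite /closed -valid eqEsubset {1}/imp_closure bigcap_inf ?clC ?subxx //=.
  by rewrite valid clop_ext.
apply/eqP; rewrite eqEsubset; apply/andP; split.
  apply: bigcap_inf; rewrite clop_ext andbT; apply/imp_closed_E_baseP.
  move=> A x /andP[/D_generatorP[xA _ _] _] AX.
  exact: subsetP (clop_sub AX) x xA.
apply/bigcapsP => C /andP[/imp_closed_E_baseP clC XC].
exact: clop_sub_closed (complete _ clC) XC.
Qed.

Lemma antichain_E_base_valid :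
  {in essential_sets phi &, forall A B : {set U}, A \subset B -> A = B} ->
  valid_base phi (E_base phi).
Proof.
move=> anti; apply/E_base_validP => C clC; apply: contraT => ncC.
have nCC : (C \subset C) && ~~ (phi C \subset C).
  by rewrite subxx; apply: contra ncC; rewrite /closed eqEsubset clop_ext andbT.
have [X /andP[XC nXC] minX] := @arg_minnP _ C
  (fun X => (X \subset C) && ~~ (phi X \subset C)) (fun X => #|phi X|) nCC.
pose Q := phi X :&: C.
have eQ : phi Q = phi X.
  apply/eqP; rewrite eqEsubset clop_sub ?subsetIl // clop_mono //.
  by rewrite subsetI clop_ext.
(* By minimality of [X], a subset of [C] with smaller closure has that closure inside [C]. *)
have qcQ : quasi_closed phi Q.
  apply/quasi_closedP => Y z; rewrite eQ subsetI => /andP[YX YC] YltX zY.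
  rewrite inE (subsetP (proper_sub YltX)) //=.
  suff /subsetP : phi Y \subset C by apply.
  have := proper_card YltX; rewrite ltnNge; apply: contraR => nYC.
  by apply: minX; rewrite YC.
have [x xX xnC] := subsetPn nXC.
have ncQ : ~~ closed phi Q.
  by apply: contra xnC => /eqP cQ; move: xX; rewrite -eQ cQ inE => /andP[].
have [A AX genA] := D_generator_exists xX (contra (subsetP XC x) xnC).
have [B genB BA] := E_generator_exists genA.
have eB : phi B = phi X.
  apply: anti; [exact: E_generator_essential genB | |].
    by rewrite -eQ; apply: quasi_closed_essential.
  exact: subset_trans BA (clop_mono _ AX).
have eA : phi A = phi B.
  by apply/eqP; rewrite eqEsubset BA eB clop_mono.
have genEA : E_generator phi x A.
  rewrite /E_generator genA eA; by case/andP: genB.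
by rewrite (clC A x genEA (subset_trans AX XC)) in xnC.
Qed.

(** * Good elements under exchange, and the antichain from validity *)

Section Exchange.
Hypothesis exchange : forall X x y,
  y \in phi (x |: X) -> y \notin phi X -> x \in phi (y |: X).
Hypothesis clop0 : phi set0 = set0.

Definition good F : {set U} :=
  [set x | [exists A, E_generator phi x A && (phi A == F)]].

Lemma goodP F x :
  reflect (exists2 A : {set U}, E_generator phi x A & phi A = F) (x \in good F).
Proof.
rewrite inE; apply: (iffP existsP) => -[A]; last first.
  by move=> genA eA; exists A; rewrite genA eA eqxx.
by case/andP=> genA /eqP eA; exists A.
Qed.

Lemma good_sub F : good F \subset F.
Proof.
by apply/subsetP => x /goodP[A /andP[/D_generatorP[xA _ _] _] <-].
Qed.

Lemma good_span F x X :
  x \in good F -> X \subset F -> x \in phi X -> x \notin X -> phi X = F.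
Proof. by case/goodP=> A genA <-; apply: E_generator_span. Qed.

Lemma good_quasi_closed F : phi (good F) = F -> quasi_closed phi (good F).
Proof.
move=> eF; apply/quasi_closedP => Y z YG; rewrite eF => YltF zY.
apply: contraT => znG.
have [A AY /D_generatorP[zA znA minA]] :=
  D_generator_exists zY (contra (subsetP YG z) znG).
have [A0 | [g gA]] := set_0Vmem A; first by rewrite A0 clop0 inE in zA.
have gF : g \in good F by rewrite (subsetP YG) ?(subsetP AY).
(* Exchange makes [g] depend on a set inside [phi Y]; as [g] is good, that set spans [F], against
   the choice of [Y]. *)
have gz : g \in phi (z |: A :\ g).
  by apply: exchange; rewrite ?setD1K // minA // properD1.
have gnz : g \notin z |: A :\ g.
  by rewrite !inE eqxx orbF; apply: contraNneq znA => <-.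
have sub : z |: A :\ g \subset phi Y.
  rewrite subUset sub1set zY (subset_trans (subsetDl _ _)) //.
  exact: subset_trans AY (clop_ext _ _).
have e := good_span gF (subset_trans sub (proper_sub YltF)) gz gnz.
by move: YltF; rewrite properE -{2}e clop_sub // andbF.
Qed.

Section Valid.
Hypothesis valid : valid_base phi (E_base phi).

(** An [E]-generator inside [Q] either spans less than [phi Q], and quasi-closedness applies, or
    spans [phi Q], and its conclusion is good. *)
Lemma valid_quasi_closed Q :
  quasi_closed phi Q -> good (phi Q) \subset Q -> closed phi Q.
Proof.
move=> /quasi_closedP qcQ gQ; move/E_base_validP: valid; apply => A x genA AQ.
have [AltQ | ] := boolP (phi A \proper phi Q).
  apply: qcQ AQ AltQ _; by have /andP[/D_generatorP[]] := genA.
rewrite properE clop_mono //= negbK => QA; apply: (subsetP gQ).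
by apply/goodP; exists A => //; apply/eqP; rewrite eqEsubset QA clop_mono.
Qed.

Lemma essential_good F : F \in essential_sets phi -> exists x, x \in good F.
Proof.
case/imsetP=> P; rewrite inE => /and3P[ncP qcP _] ->.
have [G0 | [x]] := set_0Vmem (good (phi P)); last by exists x.
by rewrite valid_quasi_closed ?G0 ?sub0set in ncP.
Qed.

Lemma essential_closed F : F \in essential_sets phi -> closed phi F.
Proof. by case/imsetP=> P _ ->; apply: closed_clop. Qed.

(* Otherwise a maximal closed [H] containing [good F :\ x] but not [x] would
   make [x |: H] a quasi-closed set that refutes validity. *)
Lemma essential_good_span F : F \in essential_sets phi -> phi (good F) = F.
Proof.
move=> essF; have clF := essential_closed essF.
have [x xG] := essential_good essF; have xF := subsetP (good_sub F) x xG.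
have [// | /eqP nspan] := eqVneq (phi (good F)) F.
(* Otherwise goodness of [x] would make [good F :\ x] span [F]. *)
have xnG : x \notin phi (good F :\ x).
  apply/negP => xG'; case: nspan; apply/eqP; rewrite eqEsubset.
  rewrite clop_sub_closed ?good_sub //= -{1}(good_span xG _ xG') ?setD11 //.
    by rewrite clop_mono ?subsetDl.
  by rewrite (subset_trans (subsetDl _ _)) ?good_sub.
pose p H := [&& closed phi H, H \subset F & x \notin H].
have [|H maxH GH] := @maxset_exists _ p (phi (good F :\ x)).
  rewrite /p closed_clop xnG andbT clop_sub_closed //.
  by rewrite (subset_trans (subsetDl _ _)) ?good_sub.
have /and3P[clH HF xnH] := maxsetp maxH.
have HE : phi H = H by apply/eqP.
have spanQ : phi (x |: H) = F.
  apply/eqP; rewrite eqEsubset clop_sub_closed ?subUset ?sub1set ?xF //=.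
  apply/subsetP => y yF; apply: contraT => ynQ.
  suff yH : y \in H by rewrite mem_clop ?inE ?yH ?orbT in ynQ.
  have pY : p (phi (y |: H)).
    rewrite /p closed_clop clop_sub_closed ?subUset ?sub1set ?yF //=.
    by apply: contra ynQ => xy; apply: exchange xy _; rewrite HE.
  have HY : H \subset phi (y |: H).
    by apply: subset_trans (clop_ext _ _); apply: subsetUr.
  by rewrite -(maxsetsup maxH pY HY) mem_clop ?setU11.
have qcQ : quasi_closed phi (x |: H).
  apply/quasi_closedP => Y z YQ; rewrite spanQ => YltF zY; apply: contraT.
  rewrite !inE negb_or => /andP[zx znH].
  have Y'H : Y :\ x \subset H by rewrite subDset.
  have znY' : z \notin phi (Y :\ x).
    by apply: contra znH; apply: (subsetP (clop_sub_closed clH Y'H)).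
  have xz : x \in phi (z |: Y :\ x).
    by apply: exchange znY'; apply: mem_clopS zY; rewrite -subDset.
  have xnz : x \notin z |: Y :\ x by rewrite !inE eqxx eq_sym (negPf zx).
  have sub : z |: Y :\ x \subset phi Y.
    rewrite subUset sub1set zY (subset_trans (subsetDl _ _)) //.
    exact: clop_ext.
  have e := good_span xG (subset_trans sub (proper_sub YltF)) xz xnz.
  by move: YltF; rewrite properE -{2}e clop_sub // andbF.
have GQ : good (phi (x |: H)) \subset x |: H.
  by rewrite spanQ -subDset (subset_trans (clop_ext phi _)).
have /eqP clQ := valid_quasi_closed qcQ GQ.
(* Now [x |: H] is all of [F], so a generator of [x] spanning [F] lies in [H], forcing [x] into
   [H]. *)
have [A /andP[/D_generatorP[xA xnA _] _] eA] := goodP _ _ xG.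
case/negP: xnH; rewrite -HE; apply: mem_clopS xA.
have AQ : A \subset x |: H by rewrite -clQ spanQ -eA clop_ext.
apply/subsetP => y yA; have := subsetP AQ y yA; rewrite !inE.
by case: eqP xnA yA => // -> /negPf->.
Qed.

Lemma valid_antichain :
  {in essential_sets phi &, forall A B : {set U}, A \subset B -> A = B}.
Proof.
move=> F F' essF essF' FF'.
have spanF' := essential_good_span essF'.
have goodF' : good F' = F'.
  rewrite -{2}spanF'; apply/esym/eqP/valid_quasi_closed.
    exact: good_quasi_closed.
  by rewrite spanF'.
have [x xF] := essential_good essF.
have [A /andP[/D_generatorP[xA xnA _] _] eA] := goodP _ _ xF.
(* [x] is also good for [F'], so [A], a nontrivial generator of [x] inside [F'], spans [F'] as well
   as [F]. *)
rewrite -eA; apply: good_span xA xnA.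
  by rewrite goodF' (subsetP FF') // (subsetP (good_sub F)).
by apply: subset_trans FF'; rewrite -eA clop_ext.
Qed.

End Valid.
End Exchange.
End Atomic.
End ClosureSpace.

Theorem theorem3 (U : finType) (phi : closure_op U) :
  standard phi ->
  geometric (closed_set phi) ->
  valid_base phi (E_base phi) <->
  {in essential_sets phi &, forall A B : {set U}, A \subset B -> A = B}.
Proof.
move=> st geo; have /andP[at_ _] := geo.
have clop1 x : phi [set x] = [set x] by apply: atomistic_clop1.
split=> [valid | ]; last exact: antichain_E_base_valid.
apply: valid_antichain valid => // [X x y|]; last exact: standard_clop0.
exact: geometric_exchange.
Qed.
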